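(* For every fixed integer $k\ge 0$, the expected fractions of nodes of rank $k$ and at layer $k$ in random recursive trees of size $n$, and their limiting values, satisfy $$|r_k(n)-r_k|\lesssim\frac{(\log n)^{k+1}}{n},\qquad |\ell_k(n)-\ell_k|\lesssim\frac{(\log n)^{k+1}}{n},$$ that is, there exists a constant $C$ (which may depend on $k$) such that $|r_k(n)-r_k|\le C(\log n)^{k+1}/n$ and $|\ell_k(n)-\ell_k|\le C(\log n)^{k+1}/n$ for all $n\ge 2$.
   Context: All logarithms are natural. A random recursive tree (RRT) $G_n$ of size $n$ is a random labeled tree on the node set $\{1,\dots,n\}$ built as follows: start with node $1$; for $t=2,\dots,n$, node $t$ is attached by an edge to one node chosen uniformly at random from the existing nodes $\{1,\dots,t-1\}$, independently of previous choices. A leaf is a node of degree $1$ (the root, node $1$, is also a leaf if it has degree $1$). The rank of a node is its graph distance to the closest leaf, so leaves have rank $0$; in the one-node tree the single node has rank $0$. The layer of a node is the number of times all current leaves must be simultaneously stripped off (removed) from the tree for the node to become a leaf; leaves of the original tree are at layer $0$, and if after some number of rounds the remaining tree consists of a single isolated node, that node counts as a leaf at that stage. Let $R_{n,k}$ and $L_{n,k}$ be the numbers of nodes of rank $k$ and at layer $k$ in $G_n$, let $r_k(n)=\mathbb E[R_{n,k}/n]$ and $\ell_k(n)=\mathbb E[L_{n,k}/n]$, and let $r_k=\lim_{n\to\infty}r_k(n)$ and $\ell_k=\lim_{n\to\infty}\ell_k(n)$ (these limits exist). *)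

(* Defs.v *)
From mathcomp Require Import all_boot all_order all_algebra.
From mathcomp Require Import all_classical all_reals all_analysis.

Set Implicit Arguments.
Unset Strict Implicit.
Unset Printing Implicit Defensive.

Import Order.TTheory GRing.Theory Num.Theory.
Import numFieldNormedType.Exports.

Local Open Scope ring_scope.

(* A finite simple graph is given by its adjacency relation [e] on a finType;
   induced subgraphs are given by their vertex sets. *)
Section Graphs.
Variables (V : finType) (e : rel V).

Definition degree_in (S : {set V}) (v : V) : nat := #|[set u in S | e v u]|.

(* The second alternative makes the only node of a one-node tree a leaf. *)
Definition leaves (S : {set V}) : {set V} :=
  [set v in S | (degree_in S v == 1%N) || (S == [set v])].

Definition strip (S : {set V}) : {set V} := S :\: leaves S.

(* A node that is a leaf after k rounds is removed in the next one, so a node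
   belongs to [layer_nodes k] for at most one k. *)
Definition layer_nodes (k : nat) : {set V} := leaves (iter k strip [set: V]).

(* Junk value #|V| (larger than every actual distance) if y is not reachable
   from x; this does not occur in a connected graph. *)
Definition graph_dist (x y : V) : nat :=
  find (fun d => [exists p : d.-tuple V, path e x p && (last x p == y)])
       (iota 0 #|V|).

Definition rank (v : V) : nat :=
  \big[minn/#|V|]_(u in leaves [set: V]) graph_dist v u.

Definition rank_nodes (k : nat) : {set V} := [set v | rank v == k].

End Graphs.

(* Nodes are numbered from 0, so 'I_n stands for {1, ..., n}.  The attachment
   choices [w] of a recursive tree of size n attach node t.+1 to node [w t],
   one of the t.+1 earlier nodes 0, ..., t. *)
Definition choices (n : nat) : finType :=
  {dffun forall t : 'I_n.-1, 'I_t.+1}.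

Definition attached (n : nat) (w : choices n) (j i : 'I_n) : bool :=
  [exists t : 'I_n.-1, (val j == t.+1) && (val i == val (w t))].

Definition rtree (n : nat) (w : choices n) : rel 'I_n :=
  fun i j => attached w i j || attached w j i.

Section RandomRecursiveTree.
Variable R : realType.

(* Independent choices, the t-th one uniform among t.+1 nodes. *)
Definition rrt_prob (n : nat) (w : choices n) : R :=
  \prod_(t < n.-1) (t.+1%:R)^-1.

Definition rrt_mean (n : nat) (X : choices n -> R) : R :=
  \sum_(w : choices n) rrt_prob w * X w.

Definition rank_frac (k n : nat) : R :=
  rrt_mean (fun w : choices n => #|rank_nodes (rtree w) k|%:R / n%:R).

Definition layer_frac (k n : nat) : R :=
  rrt_mean (fun w : choices n => #|layer_nodes (rtree w) k|%:R / n%:R).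

Definition rank_lim (k : nat) : R := limn (rank_frac k).

Definition layer_lim (k : nat) : R := limn (layer_frac k).

End RandomRecursiveTree.

(* Main.v *)
Require Import Defs.
From mathcomp Require Import all_boot all_order all_algebra.
From mathcomp Require Import all_classical all_reals all_analysis.
From mathcomp Require Import lra ring.
Import Order.TTheory GRing.Theory Num.Theory.
Import numFieldNormedType.Exports.
Local Open Scope ring_scope.
Set Implicit Arguments.
Unset Strict Implicit.
Unset Printing Implicit Defensive.

(** Deleting the edge between the first two nodes of a random recursive tree
    splits it into two trees rooted at these nodes; the sizes are uniform, and
    given the sizes the two parts are independent random recursive trees
    ([tree_mean_split]).  Conversely the tree is obtained by joining the roots of
    the two parts by an edge, which changes the rank or the layer of a node only
    if the node is close to one of the two roots: whether a node has rank k or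
    is at layer k can be read off from the tree around it up to distance k + 1
    ([survives_local]).  So, if a(n) is the mean number of nodes of rank k in a
    tree of size n,
      a(n) = (2 / (n - 1)) (a(1) + ... + a(n - 1)) + e(n),
    where e(n) is at most the mean number of nodes within distance k + 1 of the
    two roots.  There are few of them: the mean number of nodes within distance
    j of the root is at most (1 + H_(n-1))^j, with H_n the harmonic numbers
    ([tree_mean_near_root]); hence e(n) = O(log(n)^(k+1)).

    Put v(n) = a(n) - e(n).  Subtracting the recursions for n and n + 1 gives
      v(n+1) / (n+1) - v(n) / n = 2 e(n) / (n (n+1)),
    so v(n) / n converges, and its distance to the limit is at most a tail of
    the series of log(j)^(k+1) / j^2, that is O(log(n)^(k+1) / n)
    ([split_recursion_rate]).  The same rate holds for a(n) / n, as e(n) / n is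
    of the same order.

    Two points make this work for rank and layer at once.  Both are instances of
    one scheme: a set of surviving nodes shrinks step by step under a rule that
    looks only at a node and its neighbours, and the nodes of rank or layer k
    are those eliminated at step k.  The rule for layers ignores that an
    isolated node counts as a leaf, which would be a global condition; this
    changes the number of nodes at a given layer by at most one
    ([layer_nodes_deaths]), an error of order 1 / n in the fraction.

    The distribution of the tree enters only through the operator [tree_mean],
    which averages a function of rooted graphs along the growth of the tree.  It
    avoids a relabelling of the two parts: all functions of interest are
    invariant under isomorphism. *)

(** * Rooted graphs, growing and joining *)

Record rooted_graph := RootedGraph { vert : finType; adj : rel vert; root : vert }.

Definition rooted_iso (G H : rooted_graph) : Prop :=
  exists f : vert G -> vert H,
    [/\ bijective f, f (root G) = root H & {mono f : x y / adj x y}].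

Definition invariant (T : Type) (Phi : rooted_graph -> T) : Prop :=
  forall G H, rooted_iso G H -> Phi G = Phi H.

Definition single : rooted_graph := @RootedGraph unit (fun _ _ => false) tt.

(** [None] is the new vertex, attached to [x]. *)
Definition pendant_adj (V : finType) (e : rel V) (x : V) : rel (option V) :=
  fun a b => match a, b with
             | Some u, Some v => e u v
             | Some u, None | None, Some u => u == x
             | None, None => false
             end.

Definition pendant (G : rooted_graph) (x : vert G) : rooted_graph :=
  RootedGraph (pendant_adj (@adj G) x) (Some (root G)).

Definition join_adj (G H : rooted_graph) : rel (vert G + vert H)%type :=
  fun a b => match a, b with
             | inl u, inl v => adj u v
             | inr u, inr v => adj u v
             | inl u, inr v | inr v, inl u => (u == root G) && (v == root H)
             end.

Definition join (G H : rooted_graph) : rooted_graph :=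
  RootedGraph (@join_adj G H) (inl (root G)).

Lemma rooted_iso_pendant (G H : rooted_graph) (f : vert G -> vert H) (x : vert G) :
  bijective f -> f (root G) = root H -> {mono f : x y / adj x y} ->
  rooted_iso (pendant x) (pendant (f x)).
Proof.
move=> [g fK gK] fr fa; exists (omap f); split=> [||a b].
- by exists (omap g) => [[u|]|[u|]] //=; rewrite ?fK ?gK.
- by rewrite /= fr.
- case: a => [u|]; case: b => [v|] //=; rewrite ?(can_eq fK) //.
Qed.

(** Growing a joined graph grows one of its two parts; this is what makes the
    split into two random trees persist during the growth. *)
Lemma rooted_iso_join_pendantl (G H : rooted_graph) (x : vert G) :
  rooted_iso (@pendant (join G H) (inl x)) (join (pendant x) H).
Proof.
pose f (a : option (vert G + vert H)) : (option (vert G) + vert H)%type :=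
  match a with Some (inl u) => inl (Some u) | Some (inr u) => inr u
             | None => inl None end.
pose g (b : option (vert G) + vert H) : option (vert G + vert H) :=
  match b with inl (Some u) => Some (inl u) | inr u => Some (inr u)
             | inl None => None end.
exists f; split=> //; first by exists g => [[[u|u]|]|[[u|]|u]].
by case=> [[u|u]|] [[v|v]|] //=; rewrite ?eqE.
Qed.

Lemma rooted_iso_join_pendantr (G H : rooted_graph) (x : vert H) :
  rooted_iso (@pendant (join G H) (inr x)) (join G (pendant x)).
Proof.
pose f (a : option (vert G + vert H)) : (vert G + option (vert H))%type :=
  match a with Some (inr u) => inr (Some u) | Some (inl u) => inl u
             | None => inr None end.
pose g (b : vert G + option (vert H)) : option (vert G + vert H) :=
  match b with inr (Some u) => Some (inr u) | inl u => Some (inl u)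
             | inr None => None end.
exists f; split=> //; first by exists g => [[[u|u]|]|[u|[u|]]].
by case=> [[u|u]|] [[v|v]|] //=; rewrite ?eqE //= ?andbF.
Qed.

Lemma rooted_iso_pendant_single :
  rooted_iso (@pendant single tt) (join single single).
Proof.
pose f (a : option unit) : (unit + unit)%type := if a then inl tt else inr tt.
pose g (b : unit + unit) := if b is inl _ then Some tt else None.
exists f; split=> //; first by exists g => [[[]|]|[[]|[]]].
by case=> [[]|] [[]|].
Qed.

(** * The mean over a growing tree and its split at the root *)
Section TreeMean.
Variable R : realType.
Implicit Type Phi Psi : rooted_graph -> R.

Definition grow_mean Phi (G : rooted_graph) : R :=
  #|vert G|%:R^-1 * \sum_(x : vert G) Phi (pendant x).

(** The mean of [Phi] over the random recursive tree with n + 1 nodes: the last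
    step of the growth is averaged out first, so the recursion changes [Phi]
    and no probability space is needed. *)
Fixpoint tree_mean (n : nat) Phi : R :=
  if n is m.+1 then tree_mean m (grow_mean Phi) else Phi single.

Lemma invariant_grow_mean Phi : invariant Phi -> invariant (grow_mean Phi).
Proof.
move=> inv G H [f [bf fr fa]]; rewrite /grow_mean (bij_eq_card bf); congr (_ * _).
rewrite [RHS](reindex f) /=; last exact: onW_bij.
by apply: eq_bigr => x _; apply: inv; apply: rooted_iso_pendant.
Qed.

Lemma card_pendant (G : rooted_graph) (x : vert G) :
  #|vert (pendant x)| = #|vert G|.+1.
Proof. by rewrite card_option. Qed.

(** Only graphs of the right size carry mass. *)
Lemma ler_tree_mean n Phi Psi :
  (forall G, #|vert G| = n.+1 -> Phi G <= Psi G) ->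
  tree_mean n Phi <= tree_mean n Psi.
Proof.
elim: n Phi Psi => [|n IHn] Phi Psi le_PhiPsi /=.
  by apply: le_PhiPsi; rewrite card_unit.
apply: IHn => G cardG; rewrite ler_wpM2l ?invr_ge0 ?ler0n //.
by apply: ler_sum => x _; apply: le_PhiPsi; rewrite card_pendant cardG.
Qed.

Lemma eq_tree_mean n Phi Psi :
  (forall G, #|vert G| = n.+1 -> Phi G = Psi G) ->
  tree_mean n Phi = tree_mean n Psi.
Proof.
move=> eq_Phi; apply/eqP.
by rewrite eq_le !ler_tree_mean // => G cG; rewrite eq_Phi.
Qed.

Lemma tree_meanD n Phi Psi :
  tree_mean n (fun G => Phi G + Psi G) = tree_mean n Phi + tree_mean n Psi.
Proof.
elim: n Phi Psi => [|n IHn] Phi Psi //=; rewrite -IHn; apply: eq_tree_mean => G _.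
by rewrite /grow_mean big_split mulrDr.
Qed.

Lemma tree_meanZ n c Phi :
  tree_mean n (fun G => c * Phi G) = c * tree_mean n Phi.
Proof.
elim: n Phi => [|n IHn] Phi //=; rewrite -IHn; apply: eq_tree_mean => G _.
by rewrite /grow_mean -mulr_sumr mulrCA.
Qed.

Lemma tree_mean_cst n c : tree_mean n (fun=> c) = c.
Proof.
elim: n => //= n IHn; rewrite -[RHS]IHn; apply: eq_tree_mean => G cG.
by rewrite /grow_mean sumr_const cG -[c *+ _]mulr_natl mulKf ?pnatr_eq0.
Qed.

Lemma tree_mean_sum n (I : finType) (F : I -> rooted_graph -> R) :
  tree_mean n (fun G => \sum_i F i G) = \sum_i tree_mean n (F i).
Proof.
elim: n F => [|n IHn] F //=; rewrite -IHn; apply: eq_tree_mean => G _.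
by rewrite /grow_mean exchange_big mulr_sumr.
Qed.

(** By induction on the size.  If the parts have i + 1 and n - i + 1 vertices
    and their sizes are uniform, then the next vertex joins the first part with
    probability proportional to i + 1 and the second one to n - i + 1.  So the
    pair of sizes (i + 1, n - i + 2) arises with total weight i + (n + 1 - i),
    which does not depend on i: the sizes remain uniform. *)
Lemma tree_mean_split n Phi : invariant Phi ->
  tree_mean n.+1 Phi =
  n.+1%:R^-1 * \sum_(i < n.+1)
    tree_mean i (fun G => tree_mean (n - i) (fun H => Phi (join G H))).
Proof.
elim: n Phi => [|n IHn] Phi inv.
  rewrite big_ord1 invr1 mul1r /= /grow_mean card_unit invr1 mul1r.
  rewrite (bigD1 tt) //= big1 ?addr0; last by case.
  exact: inv rooted_iso_pendant_single.
pose B i j := tree_mean i (fun G => tree_mean j (fun H => Phi (join G H))).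
(* one growth step of the pair of parts, the first with i + 1 vertices *)
have step i : (i < n.+1)%N ->
  tree_mean i (fun G => tree_mean (n - i) (fun H => grow_mean Phi (join G H))) =
  n.+2%:R^-1 * (i.+1%:R * B i.+1 (n - i)%N + (n - i).+1%:R * B i (n - i).+1).
  move=> lti; rewrite mulrDr !mulrA /B /=.
  rewrite -!tree_meanZ -tree_meanD; apply: eq_tree_mean => G cG.
  rewrite /grow_mean cG -mulrA mulVKf ?pnatr_eq0 // -tree_mean_sum -!tree_meanZ.
  rewrite -tree_meanD; apply: eq_tree_mean => H cH.
  rewrite cH -[X in _ + X]mulrA mulVKf ?pnatr_eq0 // -mulrDr.
  rewrite card_sum cG cH addSnnS -addSnnS addnS addSn subnKC //.
  congr (_ * _); rewrite big_sumType; congr (_ + _); apply: eq_bigr => x _.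
  - exact: inv (rooted_iso_join_pendantl _ _).
  - exact: inv (rooted_iso_join_pendantr _ _).
transitivity (tree_mean n.+1 (grow_mean Phi)); first by [].
rewrite IHn; last exact: invariant_grow_mean.
rewrite (eq_bigr _ (fun (i : 'I_n.+1) _ => step i (ltn_ord i))) -mulr_sumr.
rewrite mulrCA; congr (_ * _); rewrite big_split /=.
rewrite -[\sum_(i < n.+2) _]/(\sum_(i < n.+2) B i (n.+1 - i)%N).
have -> : \sum_(i < n.+1) i.+1%:R * B i.+1 (n - i)%N =
          \sum_(i < n.+2) i%:R * B i (n.+1 - i)%N.
  by rewrite [RHS]big_ord_recl mul0r add0r; apply: eq_bigr => i _; rewrite subSS.
have -> : \sum_(i < n.+1) (n - i).+1%:R * B i (n - i).+1 =
          \sum_(i < n.+2) (n.+1 - i)%:R * B i (n.+1 - i)%N.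
  rewrite [RHS]big_ord_recr /= subnn mul0r addr0.
  by apply: eq_bigr => i _; rewrite subSn // -ltnS.
rewrite -big_split /= mulr_sumr; apply: eq_bigr => i _.
rewrite -mulrDl -natrD subnKC; last by rewrite -ltnS.
by rewrite mulKf ?pnatr_eq0.
Qed.

End TreeMean.

(** * Attachment choices and the growing tree *)
Section Transfer.
Variable R : realType.

Definition rooted_rtree (n : nat) (w : choices n.+1) : rooted_graph :=
  RootedGraph (rtree w) ord0.

(** The dependent type of the choices is dealt with by [inord]; every value is
    in range, so its default is never used. *)
Definition extend_choices (n : nat) (w : choices n.+1) (x : 'I_n.+1) :
    choices n.+2 :=
  [ffun t : 'I_n.+1 =>
     inord (if insub (val t) is Some t' then val (w t') else val x) : 'I_t.+1].

Definition restrict_choices (n : nat) (w : choices n.+2) :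
    choices n.+1 * 'I_n.+1 :=
  ([ffun t : 'I_n => w (widen_ord (leqnSn n) t)], w ord_max).

Lemma val_extend_widen (n : nat) (w : choices n.+1) (x : 'I_n.+1)
    (t : 'I_n) (t' : 'I_n.+1) :
  t = t' :> nat -> extend_choices w x t' = w t :> nat.
Proof.
move=> tt'; rewrite ffunE /= -tt'; case: insubP => [t2 _ t2t|]; last first.
  by rewrite ltn_ord.
have -> : t2 = t by apply: val_inj.
by rewrite inordK // (leq_trans (ltn_ord (w t))) // -tt'.
Qed.

Lemma val_extend_max (n : nat) (w : choices n.+1) (x : 'I_n.+1) (t : 'I_n.+1) :
  t = n :> nat -> extend_choices w x t = x :> nat.
Proof.
by move=> tn; rewrite ffunE /= insubN /= ?tn ?ltnn // inordK //.
Qed.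

Lemma restrictK (n : nat) :
  cancel (@restrict_choices n) (fun p => extend_choices p.1 p.2).
Proof.
move=> w; apply/ffunP => t /=; apply: val_inj => /=.
have [lt_tn|] := ltnP t n.
  rewrite (@val_extend_widen _ _ _ (Ordinal lt_tn)) // ffunE.
  by congr (val (w _)); apply: val_inj.
move=> le_nt; have tmax : t = ord_max.
  by apply: val_inj; apply/eqP; rewrite eqn_leq le_nt -ltnS ltn_ord.
by rewrite tmax val_extend_max.
Qed.

Lemma extendK (n : nat) :
  cancel (fun p : choices n.+1 * 'I_n.+1 => extend_choices p.1 p.2)
         (@restrict_choices n).
Proof.
case=> w x /=; rewrite /restrict_choices; congr pair.
  apply/ffunP => t; apply: val_inj; rewrite ffunE.
  exact: val_extend_widen.
by apply: val_inj; apply: val_extend_max.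
Qed.

Lemma rooted_iso_extend (n : nat) (w : choices n.+1) (x : 'I_n.+1) :
  rooted_iso (@pendant (rooted_rtree w) x) (rooted_rtree (extend_choices w x)).
Proof.
pose f (a : option 'I_n.+1) : 'I_n.+2 :=
  if a is Some i then widen_ord (leqnSn _) i else ord_max.
pose g (j : 'I_n.+2) : option 'I_n.+1 := insub (val j).
have attE (j i : 'I_n.+1) :
    attached (extend_choices w x) (f (Some j)) (f (Some i)) = attached w j i.
  apply/existsP/existsP => -[t /andP[/eqP /= jt /eqP /= it]].
    have lt_tn : (t < n)%N by rewrite -ltnS -jt ltn_ord.
    exists (Ordinal lt_tn); rewrite /= jt eqxx it /=.
    exact/eqP/val_extend_widen.
  exists (widen_ord (leqnSn n) t); rewrite /= jt eqxx it /=.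
  exact/eqP/esym/val_extend_widen.
have att_new (i : 'I_n.+1) :
    attached (extend_choices w x) (f None) (f (Some i)) = (i == x).
  apply/existsP/eqP => [[t /andP[/eqP /= [nt] /eqP /= it]]|->].
    by apply: val_inj; rewrite /= it; apply: val_extend_max.
  by exists ord_max; rewrite /= eqxx; apply/eqP/esym/val_extend_max.
have att_to_new (j : 'I_n.+2) :
    attached (extend_choices w x) j (f None) = false.
  apply/existsP => -[t /andP[_ /eqP /= nt]].
  by have := ltn_ord (extend_choices w x t); rewrite -nt ltnS leqNgt ltn_ord.
exists f; split.
- exists g => [[i|]|j]; rewrite /g /f.
  + by rewrite /= valK.
  + by rewrite /= insubN ?ltnn.
  + case: insubP => [i _ ij|]; first by apply: val_inj.
    rewrite -leqNgt => le_nj; apply: val_inj; apply/eqP.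
    by rewrite eqn_leq le_nj -ltnS ltn_ord.
- exact: val_inj.
- move=> [i|] [j|]; rewrite /= /rtree.
  + by rewrite !attE.
  + by rewrite att_to_new att_new.
  + by rewrite att_to_new att_new orbF.
  + by rewrite att_to_new.
Qed.

Lemma rrt_mean_extend (n : nat) (X : choices n.+2 -> R) :
  rrt_mean X =
  rrt_mean (fun w : choices n.+1 =>
              n.+1%:R^-1 * \sum_(x : 'I_n.+1) X (extend_choices w x)).
Proof.
rewrite /rrt_mean.
rewrite (reindex (fun p : choices n.+1 * 'I_n.+1 => extend_choices p.1 p.2)).
  2: apply: onW_bij; exists (@restrict_choices n).
  2: exact: extendK.
  2: exact: restrictK.
rewrite -(pair_bigA _ (fun w x =>
  rrt_prob R (extend_choices w x) * X (extend_choices w x))) /=.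
apply: eq_bigr => w _; rewrite mulrA mulr_sumr; apply: eq_bigr => x _.
by rewrite /rrt_prob /= big_ord_recr.
Qed.

(** The last attachment choice is uniform and independent of the others, so
    averaging over it is one step of [tree_mean]. *)
Lemma rrt_mean_rtree (n : nat) (Phi : rooted_graph -> R) : invariant Phi ->
  rrt_mean (fun w : choices n.+1 => Phi (rooted_rtree w)) = tree_mean n Phi.
Proof.
elim: n Phi => [|n IHn] Phi inv.
  have [w _] : exists w : choices 1, true.
    by exists (ffun0 (card_ord 0)).
  have uw (w' : choices 1) : w' = w by apply/ffunP; case.
  rewrite /rrt_mean (bigD1 w) //= big1 => [|w' /eqP[]//].
  rewrite addr0 /rrt_prob big_ord0 mul1r; apply: inv.
  exists (fun=> tt); split=> [||i j] //.
    by exists (fun=> ord0) => [i|[]]; rewrite ?ord1.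
  by symmetry; apply/negbTE/norP; split; apply/existsP => -[[]].
rewrite rrt_mean_extend /= -IHn; last exact: invariant_grow_mean.
rewrite /rrt_mean; apply: eq_bigr => w _; congr (_ * _).
rewrite /grow_mean card_ord; congr (_ * _).
by apply: eq_bigr => x _; symmetry; apply: inv (rooted_iso_extend _ _).
Qed.

End Transfer.

(** * Local elimination schemes *)
Section Observables.

(** There is a walk of length at most [k] from [v] into [B]. *)
Fixpoint reaches (V : finType) (e : rel V) (B : pred V) (k : nat) : pred V :=
  fun v => if k is j.+1
           then reaches e B j v || [exists u, e v u && reaches e B j u] else B v.

Lemma reaches_le (V : finType) (e : rel V) (B : pred V) (i j : nat) (v : V) :
  (i <= j)%N -> reaches e B i v -> reaches e B j v.
Proof.
move=> /subnK <-; elim: (j - i)%N => //= m IHm /IHm ->.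
by [].
Qed.

(** At step [j] the rule [F j] decides on the survival of a node from its own
    status and the numbers of surviving and of eliminated neighbours. *)
Variable F : nat -> bool -> nat -> nat -> bool.

Fixpoint survives (V : finType) (e : rel V) (k : nat) (v : V) : bool :=
  if k is j.+1 then
    F j (survives e j v) #|[set u | e v u && survives e j u]|
      #|[set u | e v u && ~~ survives e j u]|
  else true.

Definition dies (V : finType) (e : rel V) (k : nat) (v : V) : bool :=
  survives e k v && ~~ survives e k.+1 v.

Definition deaths (V : finType) (e : rel V) (k : nat) : nat :=
  #|[set v | dies e k v]|.

(** [f] is an isomorphism onto its image except at the vertices of [B], which
    may have additional neighbours in the target. *)
Definition local_embedding (V V' : finType) (e : rel V) (e' : rel V')
    (B : pred V) (f : V -> V') : Prop :=
  injective f /\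
  forall v u', ~~ B v -> e' (f v) u' = [exists u, (f u == u') && e v u].

Section Locality.
Variables (V V' : finType) (e : rel V) (e' : rel V') (B : pred V).
Variable f : V -> V'.
Hypothesis f_emb : local_embedding e e' B f.

Lemma card_local_embedding (v : V) (P : pred V) (P' : pred V') :
  ~~ B v -> (forall u, e v u -> P' (f u) = P u) ->
  #|[set u' | e' (f v) u' && P' u']| = #|[set u | e v u && P u]|.
Proof.
case: f_emb => inj_f nbr_f Bv PP'; rewrite -(card_imset _ inj_f).
apply: eq_card => u'; rewrite inE nbr_f //; apply/andP/imsetP.
  case=> /existsP[u /andP[/eqP <- evu]]; rewrite PP' // => Pu.
  by exists u; rewrite // inE evu.
case=> u; rewrite inE => /andP[evu Pu] ->; rewrite PP' //; split=> //.
by apply/existsP; exists u; rewrite eqxx.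
Qed.

(** Information travels along one edge per step, so after [k] steps additional
    edges at [B] are noticed only within distance [k] of [B]. *)
Lemma survives_local (k : nat) (v : V) :
  ~~ reaches e B k v -> survives e' k (f v) = survives e k v.
Proof.
elim: k v => //= k IHk v; rewrite negb_or => /andP[far_v /existsPn far_nbr].
have nBv : ~~ B v by apply: contra far_v; apply: (@reaches_le _ e B 0).
have IHn u : e v u -> survives e' k (f u) = survives e k u.
  by move=> evu; apply: IHk; have := far_nbr u; rewrite evu.
rewrite IHk // (card_local_embedding nBv IHn).
rewrite (@card_local_embedding v (fun u => ~~ survives e k u)) // => u evu.
by rewrite IHn.
Qed.

Lemma dies_local (k : nat) (v : V) :
  ~~ reaches e B k.+1 v -> dies e' k (f v) = dies e k v.
Proof.
move=> far_v; rewrite /dies !survives_local //.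
by apply: contra far_v; apply: reaches_le.
Qed.

End Locality.

(** An isomorphism is a local embedding without exceptional vertices. *)
Lemma deaths_iso (V V' : finType) (e : rel V) (e' : rel V') (f : V -> V') k :
  bijective f -> {mono f : x y / e x y >-> e' x y} -> deaths e' k = deaths e k.
Proof.
move=> bij_f fe; have [g fK gK] := bij_f.
have emb : local_embedding e e' pred0 f.
  split=> [|v u' _]; first exact: bij_inj.
  apply/idP/existsP => [evu|[u /andP[/eqP <-]]]; last by rewrite fe.
  by exists (g u'); rewrite gK eqxx -fe gK.
have far v : ~~ reaches e pred0 k.+1 v.
  elim: k.+1 v => //= j IHj v; rewrite negb_or IHj.
  by apply/existsPn => u; rewrite negb_and IHj orbT.
rewrite /deaths -[RHS](card_imset _ (bij_inj bij_f)); apply: eq_card => v'.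
rewrite inE -[v']gK (dies_local emb) // mem_imset ?inE //; exact: bij_inj.
Qed.

Definition near_root (k : nat) (G : rooted_graph) : nat :=
  #|[set v | reaches (@adj G) (pred1 (root G)) k v]|.

Lemma invariant_deaths (T : Type) (h : nat -> T) k :
  invariant (fun G => h (deaths (@adj G) k)).
Proof. by move=> G H [f [bf _ fe]]; rewrite (deaths_iso k bf fe). Qed.

Lemma join_embl (G H : rooted_graph) :
  local_embedding (@adj G) (@adj (join G H)) (pred1 (root G)) inl.
Proof.
split=> [u v []|v [u|u] /= /negbTE vr] //.
  apply/idP/existsP => [evu|[w /andP[/eqP[->]]]] //.
  by exists u; rewrite eqxx.
by rewrite vr; apply/esym/existsP => -[].
Qed.

Lemma join_embr (G H : rooted_graph) :
  local_embedding (@adj H) (@adj (join G H)) (pred1 (root H)) inr.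
Proof.
split=> [u v []|v [u|u] /= /negbTE vr] //.
  by rewrite vr andbF; apply/esym/existsP => -[].
apply/idP/existsP => [evu|[w /andP[/eqP[->]]]] //.
by exists u; rewrite eqxx.
Qed.

Lemma leq_deaths_part (V V' : finType) (e : rel V) (e' : rel V') (B : pred V)
    (f : V -> V') (k : nat) : local_embedding e e' B f ->
  (#|[set v | dies e' k (f v)]|
     <= deaths e k + #|[set v | reaches e B k.+1 v]|)%N /\
  (deaths e k
     <= #|[set v | dies e' k (f v)]| + #|[set v | reaches e B k.+1 v]|)%N.
Proof.
move=> emb; split; apply: leq_trans (leq_card_setU _ _); apply: subset_leq_card;
  apply/fintype.subsetP => v; rewrite !inE;
  case: (boolP (reaches _ _ k.+1 v)) => [_|far_v];
  by rewrite ?orbT // (dies_local emb far_v) => ->.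
Qed.

(** Both parts are locally embedded in the joined graph, with their roots as the
    only exceptional vertices. *)
Lemma deaths_join (R : realType) (G H : rooted_graph) (k : nat) :
  `|(deaths (@adj (join G H)) k)%:R -
    ((deaths (@adj G) k)%:R + (deaths (@adj H) k)%:R)|
    <= (near_root k.+1 G)%:R + (near_root k.+1 H)%:R :> R.
Proof.
have -> : deaths (@adj (join G H)) k =
    (#|[set v | dies (@adj (join G H)) k (inl v)]|
     + #|[set v | dies (@adj (join G H)) k (inr v)]|)%N.
  rewrite /deaths !cardsE -!sum1_card big_sumType.
  by congr (_ + _)%N; apply: eq_bigl.
have [] := leq_deaths_part k (join_embl G H).
have [] := leq_deaths_part k (join_embr G H).
rewrite -/(near_root k.+1 G) -/(near_root k.+1 H).
rewrite -!(ler_nat R) !natrD => h1 h2 h3 h4.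
by rewrite ler_norml; apply/andP; split; lra.
Qed.

End Observables.

(** * Nodes near the root *)
Section Depth.
Variable R : realType.

(** The harmonic number plus one, as the proofs need a quantity that is at
    least 1 also at n = 0. *)
Definition harm (n : nat) : R := 1 + series harmonic n.

Lemma harmS n : harm n.+1 = harm n + n.+1%:R^-1.
Proof. by rewrite /harm seriesS /= -addrA [_ + series _ _]addrC. Qed.

Lemma harm0 : harm 0 = 1.
Proof. by rewrite /harm /series /= big_geq // addr0. Qed.

Lemma le_harm m n : (m <= n)%N -> harm m <= harm n.
Proof.
move=> /subnK <-; elim: (n - m)%N => //= d IHd; apply: (le_trans IHd).
by rewrite addSn harmS lerDl invr_ge0.
Qed.

Lemma harm_ge1 n : 1 <= harm n.
Proof. by rewrite -harm0 le_harm. Qed.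

(** A pendant vertex creates no shortcuts, and it is within distance k + 1 of the
    root only if the vertex it is attached to is within distance k. *)
Lemma near_root_pendant (k : nat) (G : rooted_graph) (x : vert G) :
  (near_root k.+1 (pendant x)
     <= near_root k.+1 G + reaches (@adj G) (pred1 (root G)) k x)%N.
Proof.
pose nr := reaches (@adj G) (pred1 (root G)).
pose nr' := reaches (@adj (pendant x)) (pred1 (root (pendant x))).
have key j : (forall v, nr' j (Some v) -> nr j v) /\
             (nr' j None -> (0 < j)%N && nr j.-1 x).
  elim: j => [|j [IHs IHn]]; first by split=> [v /= /eqP[->]|] //=; apply: eqxx.
  split=> [v|] /= /orP[].
  - by move=> /IHs; rewrite /nr /= => ->.
  - case/existsP => -[u|] /= /andP[].
      move=> evu /IHs nru; apply/orP; right; apply/existsP; exists u.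
      by rewrite evu.
    move=> /eqP -> /IHn /andP[j0 nrx].
    by apply/orP; left; apply: reaches_le nrx; apply: leq_pred.
  - by move=> /IHn /andP[j0]; apply: reaches_le; apply: leq_pred.
  - by case/existsP => -[u|] //= /andP[/eqP -> /IHs].
have [keyS keyN] := key k.+1.
have -> : near_root k.+1 G = #|[set Some v | v in [set v | nr k.+1 v]]|.
  by rewrite card_imset //; apply: Some_inj.
have -> : nat_of_bool (reaches (@adj G) (pred1 (root G)) k x) =
    #|[set a : option (vert G) | (a == None) && nr k x]|.
  rewrite -/(nr k x); case: (nr k x) => /=.
    rewrite -[LHS](cards1 (None : option (vert G))).
    by apply: eq_card => a; rewrite !inE andbT.
  rewrite -[LHS](@cards0 (option (vert G))).
  by apply: eq_card => a; rewrite !inE andbF.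
apply: leq_trans (leq_card_setU _ _); apply: subset_leq_card.
apply/fintype.subsetP => -[u|]; rewrite !inE.
  by move=> /keyS nru; rewrite imset_f ?inE.
by move=> /keyN /= ->; rewrite orbT.
Qed.

Lemma near_root0 (G : rooted_graph) : near_root 0 G = 1%N.
Proof.
rewrite /near_root -[RHS](cards1 (root G)).
by apply: eq_card => v; rewrite !inE.
Qed.

(** Since the new node picks its neighbour uniformly among n + 1 nodes, the mean
    number of nodes within distance k + 1 of the root increases by at most
    1 / (n + 1) times the mean number within distance k; the power of
    [harm n + 1 / (n + 1)] increases by at least as much. *)
Lemma tree_mean_near_root (n k : nat) :
  tree_mean n (fun G => (near_root k G)%:R : R) <= harm n ^+ k.
Proof.
elim: n k => [|n IHn] [|k].
- by rewrite /= near_root0.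
- by rewrite /= harm0 expr1n -[leRHS]/(1%:R) ler_nat -[1%N]card_unit max_card.
- by under eq_tree_mean do rewrite near_root0; rewrite tree_mean_cst.
- apply: (@le_trans _ _ (tree_mean n (fun G =>
      (near_root k.+1 G)%:R + n.+1%:R^-1 * (near_root k G)%:R))).
    rewrite [leLHS]/=; apply: ler_tree_mean => G cG; rewrite /grow_mean cG.
    have -> : (near_root k.+1 G)%:R + n.+1%:R^-1 * (near_root k G)%:R =
        n.+1%:R^-1 * \sum_(x : vert G)
          ((near_root k.+1 G)%:R + (reaches (@adj G) (pred1 (root G)) k x)%:R : R).
      rewrite big_split /= sumr_const cG mulrDr.
      rewrite -[(near_root _ _)%:R *+ _]mulr_natl mulKf ?pnatr_eq0 //.
      rewrite -natr_sum; congr (_ + _ * _%:R).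
      rewrite /near_root cardsE -sum1_card big_mkcond.
      apply: eq_bigr => v _; rewrite -[v \in _]/(reaches _ _ k v).
      by case: (reaches _ _ k v).
    rewrite ler_wpM2l ?invr_ge0 //; apply: ler_sum => x _.
    by rewrite -natrD ler_nat near_root_pendant.
  rewrite tree_meanD tree_meanZ harmS.
  have h0 : 0 <= harm n := le_trans ler01 (harm_ge1 n).
  have i0 : 0 <= n.+1%:R^-1 :> R by rewrite invr_ge0.
  apply: (@le_trans _ _ (harm n ^+ k.+1 + n.+1%:R^-1 * harm n ^+ k)).
    by rewrite lerD ?ler_wpM2l ?IHn.
  have s0 := addr_ge0 h0 i0.
  rewrite exprS -mulrDl [leRHS]exprS ler_wpM2l //.
  by apply: lerXn2r; rewrite ?nnegrE // lerDl.
Qed.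

End Depth.

(** * The split recursion and its rate of convergence *)
Section Rate.
Variable R : realType.
Local Notation L := (@harm R).

Definition mean_deaths (F : nat -> bool -> nat -> nat -> bool) (k n : nat) : R :=
  tree_mean n (fun G => (deaths F (@adj G) k)%:R).

(** Averaging [deaths_join] over the split; the two parts contribute equally
    because i and n - i have the same distribution. *)
Lemma mean_deaths_recursion (F : nat -> bool -> nat -> nat -> bool) (k n : nat) :
  `|mean_deaths F k n.+1 - 2 / n.+1%:R * \sum_(i < n.+1) mean_deaths F k i|
    <= 2 * L n.+1 ^+ k.+1.
Proof.
set a := mean_deaths F k.
pose D i := tree_mean i (fun G => (near_root k.+1 G)%:R : R).
have DL i : (i < n.+1)%N -> D i <= L n.+1 ^+ k.+1.
  move=> lti; apply: le_trans (tree_mean_near_root _ _ _) _.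
  have := harm_ge1 R; have := le_harm R (ltnW lti) => h1 h2.
  by apply: lerXn2r; rewrite ?nnegrE // (le_trans ler01).
have symm (b : nat -> R) : \sum_(i < n.+1) b (n - i)%N = \sum_(i < n.+1) b i.
  rewrite (reindex_inj rev_ord_inj) /=; apply: eq_bigr => i _.
  by rewrite subSS subKn // -ltnS.
have -> : 2 / n.+1%:R * \sum_(i < n.+1) a i =
    n.+1%:R^-1 * \sum_(i < n.+1) (a i + a (n - i)%N).
  by rewrite big_split /= symm; ring.
have bnd : \sum_(i < n.+1) (D i + D (n - i)%N) <= n.+1%:R * (2 * L n.+1 ^+ k.+1).
  rewrite big_split /= symm.
  have : \sum_(i < n.+1) D i <= \sum_(i < n.+1) L n.+1 ^+ k.+1.
    by apply: ler_sum => i _; apply: DL.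
  by rewrite sumr_const card_ord -mulr_natl; lra.
have inv : invariant (fun G => (deaths F (@adj G) k)%:R : R).
  exact: (invariant_deaths F (fun m => m%:R)).
rewrite {1}/a {1}/mean_deaths tree_mean_split // -mulrBr.
rewrite normrM ger0_norm ?invr_ge0 //.
rewrite mulrC ler_pdivrMr ?ltr0n // [leRHS]mulrC; apply: le_trans bnd.
rewrite -sumrB; apply: le_trans (ler_norm_sum _ _ _) _; apply: ler_sum => i _.
have join_mean (f : rooted_graph -> R) :
  tree_mean i f + tree_mean (n - i) f =
  tree_mean i (fun G => tree_mean (n - i) (fun H => f G + f H)).
  rewrite -[X in _ + X](tree_mean_cst i) -tree_meanD; apply: eq_tree_mean => G _.
  by rewrite tree_meanD tree_mean_cst.
rewrite /a /mean_deaths /D !join_mean.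
pose X H := (deaths F (@adj H) k)%:R : R.
pose Y G := (near_root k.+1 G)%:R : R.
have le2 (f g : rooted_graph -> rooted_graph -> R) :
  (forall G H, f G H <= g G H) ->
  tree_mean i (fun G => tree_mean (n - i) (f G)) <=
  tree_mean i (fun G => tree_mean (n - i) (g G)).
  by move=> fg; apply: ler_tree_mean => G _; apply: ler_tree_mean.
have add2 (f g : rooted_graph -> rooted_graph -> R) :
  tree_mean i (fun G => tree_mean (n - i) (fun H => f G H + g G H)) =
  tree_mean i (fun G => tree_mean (n - i) (f G)) +
  tree_mean i (fun G => tree_mean (n - i) (g G)).
  by rewrite -tree_meanD; apply: eq_tree_mean => G _; rewrite tree_meanD.
have main G H := deaths_join F R G H k.
rewrite ler_distl; apply/andP; split.
  rewrite lerBlDr -add2; apply: le2 => G H.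
  by have := main G H; rewrite ler_distl => /andP[]; lra.
rewrite -add2; apply: le2 => G H.
by have := main G H; rewrite ler_distl => /andP[]; lra.
Qed.

(** The sequence [g] dominates the tails of the series of
    [harm n ^+ k / ((n + 1) (n + 2))] in telescoping form.  It imitates the
    antiderivative of log(x)^k / x^2: summation by parts of the series for
    k + 1 leaves the boundary term [harm n ^+ k.+1 / (n + 1)] and a multiple of
    the series for k. *)
Lemma harm_tail_potential (k : nat) :
  exists (g : nat -> R) (c : R),
    [/\ 0 <= c, forall n, L n ^+ k / n.+1%:R <= g n <= c * (L n ^+ k / n.+1%:R)
      & forall n, L n ^+ k / (n.+1%:R * n.+2%:R) <= g n - g n.+1].
Proof.
have h1 := harm_ge1 R.
have h0 n : 0 <= L n by apply: le_trans (h1 n).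
elim: k => [|k [g [c [c0 gb gd]]]].
  exists (fun n => n.+1%:R^-1), 1; split=> // n.
    by rewrite expr0 !mul1r lexx.
  rewrite expr0 mul1r -(natr1 n.+1) -(natr1 n).
  have n0 : 0 <= n%:R :> R by [].
  by rewrite le_eqVlt; apply/orP; left; apply/eqP; field; lra.
(* [k.+1] is the derivative of the power; [2 ^+ k] pays for replacing [L n.+1]
   by [L n], as [L n.+1 <= 2 * L n] *)
pose d : R := k.+1%:R * 2 ^+ k.
have d0 : 0 <= d by rewrite mulr_ge0 // exprn_ge0.
exists (fun n => L n ^+ k.+1 / n.+1%:R + d * g n), (1 + d * c); split=> [||n].
- by rewrite addr_ge0 // mulr_ge0.
- move=> n; have /andP[gl gc] := gb n.
  have g0 : 0 <= g n by apply: le_trans gl; rewrite divr_ge0 // exprn_ge0.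
  have X0 : 0 <= L n ^+ k.+1 / n.+1%:R by rewrite divr_ge0 // exprn_ge0.
  have dg0 : 0 <= d * g n by apply: mulr_ge0.
  apply/andP; split; first by rewrite lerDl.
  rewrite mulrDl mul1r lerD2l -mulrA ler_wpM2l //.
  apply: le_trans gc _; rewrite ler_wpM2l // ler_wpM2r ?invr_ge0 //.
  by rewrite exprS ler_peMl // exprn_ge0.
set N := n.+1%:R; set N' := n.+2%:R.
have N0 : 0 < N :> R by rewrite ltr0n.
have N'0 : 0 < N' :> R by rewrite ltr0n.
have NN' : N' = N + 1 :> R by rewrite natr1.
have incr : L n.+1 ^+ k.+1 - L n ^+ k.+1 <= d * L n ^+ k / N.
  have step : L n <= L n.+1 by apply: le_harm.
  rewrite subrXX; have -> : L n.+1 - L n = N^-1 by rewrite harmS addrAC subrr add0r.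
  rewrite mulrC ler_pM2r ?invr_gt0 // /d -mulrA -exprMn.
  have double : L n.+1 <= 2 * L n.
    rewrite harmS mulr2n mulrDl mul1r lerD2l (le_trans _ (h1 n)) //.
    by rewrite invf_le1 ?ler1n.
  apply: (@le_trans _ _ (\sum_(i < k.+1) (2 * L n) ^+ k)); last first.
    by rewrite sumr_const card_ord -[leLHS]mulr_natl.
  apply: ler_sum => i _; apply: (@le_trans _ _ (L n.+1 ^+ k)).
    rewrite -[in leRHS](subnK (_ : i <= k)%N) ?exprD -1?ltnS //.
    rewrite ler_wpM2l ?exprn_ge0 //.
    by apply: lerXn2r; rewrite ?nnegrE.
  by apply: lerXn2r; rewrite ?nnegrE // mulr_ge0.
have := ler_wpM2l d0 (gd n); rewrite -/N -/N' => hg.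
have : (L n.+1 ^+ k.+1 - L n ^+ k.+1) / N' <= d * L n ^+ k / N / N'.
  by apply: ler_wpM2r incr; rewrite invr_ge0 ltW.
have -> : d * L n ^+ k / N / N' = d * (L n ^+ k / (N * N')).
  by rewrite invfM !mulrA.
have -> : L n ^+ k.+1 / (N * N') = L n ^+ k.+1 / N - L n ^+ k.+1 / N'.
  rewrite -mulrBr; congr (_ * _).
  have -> : N^-1 - N'^-1 = (N' - N) * (N * N')^-1.
    by rewrite mulrBl invfM (mulVKf (lt0r_neq0 N0)) mulrCA divff ?mulr1 ?gt_eqF.
  by rewrite NN' addrAC subrr add0r mul1r.
rewrite mulrBl; move: hg; rewrite mulrBr.
move=> hg hL; have := le_trans hL hg.
move: (L n.+1 ^+ _ / _) (L n ^+ k.+1 / N) (L n ^+ k.+1 / N') => x y z.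
move: (d * g n) (d * g n.+1) => u v; lra.
Qed.

End Rate.

Section Limits.
Variable R : realType.
Local Notation L := (@harm R).
Local Open Scope classical_set_scope.

(** With the error term removed, [a n.+1 / (n + 2)] becomes [y n], whose
    increments are explicit multiples of the errors.  They are dominated by the
    increments of the potential [g], so the sequences y + 2 A g and y - 2 A g
    are monotone and enclose the limit. *)
Lemma split_recursion_rate (a : nat -> R) (A : R) (k : nat) :
  (forall n, `|a n.+1 - 2 / n.+1%:R * \sum_(i < n.+1) a i| <= A * L n.+1 ^+ k) ->
  exists l C, forall n, `|a n.+1 / n.+2%:R - l| <= C * (L n.+1 ^+ k / n.+2%:R).
Proof.
move=> rec_a; have [g [c [c0 gb gd]]] := harm_tail_potential R k.
have L0 n : 0 < L n ^+ k by rewrite exprn_gt0 // (lt_le_trans ltr01) // harm_ge1.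
have A0 : 0 <= A by rewrite -(pmulr_lge0 _ (L0 1%N)) (le_trans _ (rec_a 0%N)).
pose S n := \sum_(i < n.+1) a i.
pose y n := 2 / (n.+1%:R * n.+2%:R) * S n.
pose e n := a n.+1 - 2 / n.+1%:R * S n.
have incr n : y n.+1 - y n = 2 * e n / (n.+2%:R * n.+3%:R).
  rewrite /y /e {1}/S big_ord_recr /= -/(S n) -!(natr1 n.+2) -!(natr1 n.+1).
  have : 0 < n.+1%:R :> R by rewrite ltr0n.
  move: (n.+1%:R) (a n.+1) (S n) => N x s N0; field.
  by apply/and3P; split; lra.
have incr_le n : `|y n.+1 - y n| <= 2 * A * (g n.+1 - g n.+2).
  rewrite incr normrM normrM ger0_norm //.
  rewrite [X in _ * X]ger0_norm ?invr_ge0 ?mulr_ge0 //.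
  rewrite -!mulrA ler_wpM2l //; apply: le_trans (ler_wpM2l A0 (gd n.+1)).
  by rewrite mulrA ler_wpM2r ?invr_ge0 ?mulr_ge0 // rec_a.
pose up n := y n + 2 * A * g n.+1; pose dn n := y n - 2 * A * g n.+1.
have up_nincr : nonincreasing_seq up.
  apply/nonincreasing_seqP => n; have := incr_le n.
  by rewrite mulrBr ler_norml /up => /andP[_]; lra.
have dn_ndecr : nondecreasing_seq dn.
  apply/nondecreasing_seqP => n; have := incr_le n.
  by rewrite mulrBr ler_norml /dn => /andP[+ _]; lra.
have Ag0 n : 0 <= 2 * A * g n.
  have /andP[+ _] := gb n; move/(le_trans _) => g0; rewrite !mulr_ge0 // g0 //.
  by rewrite divr_ge0 // ltW.
have dn_up m n : dn m <= up n.
  apply: (@le_trans _ _ (dn (maxn m n))); first by rewrite dn_ndecr // leq_maxl.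
  apply: (@le_trans _ _ (up (maxn m n))); last by rewrite up_nincr // leq_maxr.
  by have := Ag0 (maxn m n).+1; rewrite /dn /up; lra.
have cvg_up : cvgn up.
  by apply: nonincreasing_is_cvgn => //; exists (dn 0%N) => _ [n _ <-].
exists (limn up), (A + 2 * A * c) => n.
have l_up := nonincreasing_cvgn_ge up_nincr cvg_up n.
have l_dn : dn n <= limn up by apply: limr_ge => //; apply: nearW.
have dist_y : `|y n - limn up| <= 2 * A * g n.+1.
  by move: l_up l_dn; rewrite ler_distl /up /dn => *; apply/andP; split; lra.
rewrite (_ : a n.+1 / n.+2%:R - limn up =
             e n / n.+2%:R + (y n - limn up)); last first.
  rewrite /e /y mulrBl; set s := S n.
  have -> : 2 / (n.+1%:R * n.+2%:R) * s = 2 / n.+1%:R * s / n.+2%:R :> R.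
    by rewrite invfM; ring.
  ring.
apply: le_trans (ler_normD _ _) _; rewrite [leRHS]mulrDl; apply: lerD.
  rewrite normrM [X in _ * X]ger0_norm ?invr_ge0 // mulrA.
  by rewrite ler_wpM2r ?invr_ge0 // rec_a.
apply: le_trans dist_y _; rewrite -[leRHS]mulrA ler_wpM2l ?mulr_ge0 //.
by have /andP[] := gb n.+1.
Qed.

(** The potential for k + 1 is nonincreasing, hence [harm n ^+ k.+1 / (n + 1)] is
    bounded; dividing by [harm n] gives 0 because the harmonic series
    diverges. *)
Lemma cvg_harm_pow (k : nat) : (fun n => L n ^+ k / n.+1%:R) @ \oo --> (0 : R).
Proof.
have [g [c [_ gb gd]]] := harm_tail_potential R k.+1.
have L0 n : 0 < L n by rewrite (lt_le_trans ltr01) // harm_ge1.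
have g_nincr : nonincreasing_seq g.
  apply/nonincreasing_seqP => n; rewrite -subr_ge0; apply: le_trans (gd n).
  by rewrite divr_ge0 ?exprn_ge0 ?mulr_ge0 // ltW.
have bnd n : L n ^+ k / n.+1%:R <= g 0%N * (L n)^-1.
  rewrite ler_pdivlMr // mulrAC -exprSr.
  have /andP[g_lb _] := gb n; apply: le_trans g_lb _; exact: g_nincr.
have L_infty : L @ \oo --> +oo.
  apply: nondecreasing_dvgn_lt => [m n|]; first exact: le_harm.
  move=> cvL; apply: (@dvg_harmonic R).
  rewrite (_ : series harmonic = fun n => L n - 1); last first.
    by apply/funext => n; rewrite /harm addrAC subrr add0r.
  by apply: is_cvgB => //; apply: is_cvg_cst.
apply: (@squeeze_cvgr _ _ _ _ (fun=> 0) (fun n => g 0%N * (L n)^-1)).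
- by apply: nearW => n; rewrite bnd divr_ge0 // exprn_ge0 // ltW.
- exact: cvg_cst.
- rewrite -[X in _ --> X](mulr0 (g 0%N)); apply: cvgMr.
  by apply/gtr0_cvgV0 => //; apply: nearW.
Qed.

Lemma harm_le_ln n : L n.+1 <= 2 + ln (n.+1%:R : R).
Proof.
elim: n => [|n IHn]; first by rewrite harmS harm0 invr1 ln1 addr0.
rewrite harmS (le_trans (lerD IHn (lexx _))) // -addrA lerD2l.
have N0 : 0 < n.+1%:R :> R by rewrite ltr0n.
have N'0 : 0 < n.+2%:R :> R by rewrite ltr0n.
rewrite -lerBrDl.
have : ln (1 + - n.+2%:R^-1 : R) <= - n.+2%:R^-1.
  by apply: le_ln1Dx; rewrite ltrN2 invf_lt1 // ltr1n.
have -> : 1 + - n.+2%:R^-1 = n.+1%:R / n.+2%:R :> R.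
  by rewrite -{1}(divff (lt0r_neq0 N'0)) -mulN1r -mulrDl -(natr1 n.+1) addrK.
by rewrite ln_div ?posrE // -[leLHS]opprB lerN2.
Qed.

End Limits.

(** * Ranks and layers as elimination schemes *)
Section RankLayer.

(** Survivors with exactly one surviving neighbour are stripped. *)
Definition layer_rule (j : nat) (b : bool) (t f : nat) : bool := b && (t != 1%N).

(** After [k] steps the survivors are the nodes at distance at least [k] from
    all leaves: leaves are eliminated at the first step, the neighbours of
    eliminated nodes later. *)
Definition rank_rule (j : nat) (b : bool) (t f : nat) : bool :=
  if j is 0%N then t != 1%N else b && (f == 0%N).

Variables (V : finType) (e : rel V).

(** The two ways of stripping can only part when a single node remains: it is
    stripped as a leaf, but may survive [layer_rule] forever. *)
Lemma strip_survives (k : nat) :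
  iter k (strip e) [set: V] = [set v | survives layer_rule e k v] \/
  iter k (strip e) [set: V] = finset.set0 /\
    exists v, [set v | survives layer_rule e k v] \subset [set v].
Proof.
elim: k => [|k IHk]; first by left; apply/setP => v; rewrite !inE.
rewrite iterS; set S := iter k _ _ in IHk *.
set S' := [set v | _] in IHk.
have sub : [set v | survives layer_rule e k.+1 v] \subset S'.
  by apply/fintype.subsetP => v; rewrite !inE => /andP[].
have strip0 : strip e finset.set0 = finset.set0 by rewrite /strip finset.set0D.
case: IHk => [SS'|[-> [v sv]]]; last first.
  by right; split=> //; exists v; apply: fintype.subset_trans sv.
have [/existsP[v /eqP Sv]|/existsPn nS1] := boolP [exists v, S == [set v]].
  right; split; last by exists v; rewrite -Sv SS'.
  rewrite /strip; apply/eqP; rewrite finset.setD_eq0; apply/fintype.subsetP => u.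
  by rewrite Sv !inE => /eqP ->; rewrite !eqxx orbT.
left; apply/setP => v; rewrite !inE (negbTE (nS1 v)) orbF /= /layer_rule.
have -> : (v \in S) = survives layer_rule e k v by rewrite SS' inE.
have -> : degree_in e S v = #|[set u | e v u && survives layer_rule e k u]|.
  by apply: eq_card => u; rewrite !inE SS' inE andbC.
by case: survives => /=; rewrite ?andbF ?andbT.
Qed.

Lemma layer_nodes_deaths (k : nat) :
  (#|layer_nodes e k| <= deaths layer_rule e k + 1)%N /\
  (deaths layer_rule e k <= #|layer_nodes e k| + 1)%N.
Proof.
rewrite /layer_nodes; set S := iter k _ _.
have := strip_survives k; rewrite -/S; set S' := [set v | _].
have le_deaths : (deaths layer_rule e k <= #|S'|)%N.
  by apply: subset_leq_card; apply/fintype.subsetP => v; rewrite !inE => /andP[].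
have le_leaves : (#|leaves e S| <= #|S|)%N.
  by apply: subset_leq_card; apply/fintype.subsetP => v; rewrite !inE => /andP[].
case=> [SS'|[S0 [v sv]]]; last first.
  have S'1 : (#|S'| <= 1)%N by rewrite -(cards1 v) subset_leq_card.
  split; last exact: leq_trans (leq_trans le_deaths S'1) (leq_addl _ _).
  by rewrite (leq_trans le_leaves) // S0 cards0.
have [/existsP[v /eqP Sv]|/existsPn nS1] := boolP [exists v, S == [set v]].
  have S1 : #|S| = 1%N by rewrite Sv cards1.
  by rewrite -SS' in le_deaths; rewrite S1 in le_deaths le_leaves; split;
    [apply: leq_trans le_leaves _ | apply: leq_trans le_deaths _]; rewrite leq_addl.
suff -> : leaves e S = [set v | dies layer_rule e k v].
  by rewrite -/(deaths _ _ _) leq_addr.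
apply/setP => v; rewrite !inE (negbTE (nS1 v)) orbF /dies /= /layer_rule.
have -> : (v \in S) = survives layer_rule e k v by rewrite SS' inE.
have -> : degree_in e S v = #|[set u | e v u && survives layer_rule e k u]|.
  by apply: eq_card => u; rewrite !inE SS' inE andbC.
by case: survives => //=; rewrite negbK.
Qed.

Lemma rank_survivesP (k : nat) (v : V) :
  reflect (exists p : seq V,
             [/\ (size p < k)%N, path e v p & #|[set u | e (last v p) u]| = 1%N])
          (~~ survives rank_rule e k v).
Proof.
apply: (iffP idP); elim: k v => [|[|k] IHk] v //=.
- rewrite negbK => /eqP d1; exists [::]; split=> //=; rewrite -[RHS]d1.
  by apply: eq_card => u; rewrite !inE andbT.
- rewrite negb_and => /orP[/IHk[p [lt_p ep lp]]|].
    by exists p; split=> //; apply: ltnW.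
  rewrite -lt0n => /card_gt0P[u]; rewrite inE => /andP[evu /IHk[p [lt_p ep lp]]].
  by exists (u :: p); split=> //=; rewrite evu.
- by case=> p [].
- case=> -[|u p] [] //= _ _ d1; rewrite negbK -[X in _ == X]d1; apply/eqP.
  by apply: eq_card => u; rewrite !inE andbT.
case=> -[|u p] [lt_p ep lp]; rewrite negb_and; apply/orP.
  by left; apply: IHk; exists [::].
move: ep => /= /andP[evu ep]; right; rewrite -lt0n; apply/card_gt0P.
by exists u; rewrite inE evu; apply: IHk; exists p.
Qed.

Lemma graph_dist_ltP (v u : V) (k : nat) : (k <= #|V|)%N ->
  reflect (exists p : seq V, [/\ (size p < k)%N, path e v p & last v p = u])
          (graph_dist e v u < k)%N.
Proof.
move=> le_kV; rewrite /graph_dist -has_take_leq ?size_iota // take_iota.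
rewrite (minn_idPl le_kV).
apply: (iffP hasP) => [[d]|[p [lt_p ep lp]]].
  rewrite mem_iota => /andP[_ ltd] /existsP[p /andP[ep /eqP lp]].
  by exists p; rewrite size_tuple.
exists (size p); first by rewrite mem_iota.
by apply/existsP; exists (in_tuple p); rewrite /= ep lp eqxx.
Qed.

Lemma bigminn_lt (I : finType) (P : pred I) (G : I -> nat) (m k : nat) :
  (k <= m)%N ->
  (\big[minn/m]_(i | P i) G i < k)%N = [exists i, P i && (G i < k)%N].
Proof.
move=> le_km.
transitivity (has (fun i => P i && (G i < k)%N) (index_enum I)).
  elim: index_enum => [|i r IHr]; first by rewrite big_nil ltnNge le_km.
  by rewrite big_cons /=; case: (P i) => //=; rewrite gtn_min IHr.
by apply/hasP/existsP => [[i _ Gi]|[i Gi]]; exists i; rewrite ?mem_index_enum.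
Qed.

Lemma rank_lt (k : nat) (v : V) : (1 < #|V|)%N -> (k <= #|V|)%N ->
  (rank e v < k)%N = ~~ survives rank_rule e k v.
Proof.
move=> V2 le_kV; rewrite /rank bigminn_lt //.
have leafE u : (u \in leaves e [set: V]) = (#|[set w | e u w]| == 1%N).
  rewrite !inE (_ : [set: V] == [set u] = false) ?orbF.
    by congr (_ == _); apply: eq_card => w; rewrite !inE.
  by apply/negP => /eqP Vu; rewrite -cardsT Vu cards1 in V2.
apply/existsP/rank_survivesP => [[u]|[p [lt_p ep /eqP lp]]].
  rewrite leafE => /andP[/eqP lu /graph_dist_ltP[//|p [lt_p ep lp]]].
  by exists p; rewrite lp.
exists (last v p); rewrite leafE lp; apply/graph_dist_ltP => //.
by exists p.
Qed.

(** The two notions agree if there are more than k + 1 nodes.  In smaller graphs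
    the junk value of the distance and the leaf of the one-node tree matter,
    but there both counts are at most k + 1. *)
Lemma rank_nodes_deaths (k : nat) :
  (#|rank_nodes e k| <= deaths rank_rule e k + k.+1)%N /\
  (deaths rank_rule e k <= #|rank_nodes e k| + k.+1)%N.
Proof.
have [le_Vk|lt_kV] := leqP #|V| k.+1.
  by split; rewrite (leq_trans (leq_trans (max_card _) le_Vk)) // leq_addl.
suff -> : rank_nodes e k = [set v | dies rank_rule e k v].
  by rewrite -/(deaths _ _ _) leq_addr.
apply/setP => v; rewrite !inE /dies.
rewrite -rank_lt ?(leq_ltn_trans _ lt_kV) //.
rewrite -[survives _ _ _ _]negbK -rank_lt ?(leq_ltn_trans _ lt_kV) //.
  by rewrite -leqNgt ltnS eqn_leq andbC.
by rewrite ltnW // ltnW.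
Qed.

End RankLayer.

(** * The fractions of nodes *)
Section FractionRate.
Variable R : realType.
Local Notation L := (@harm R).

Lemma rrt_mean_dist (n : nat) (X Y : choices n.+1 -> R) (c : R) :
  (forall w, `|X w - Y w| <= c) -> `|rrt_mean X - rrt_mean Y| <= c.
Proof.
move=> XYc; rewrite /rrt_mean -sumrB.
have prob0 (w : choices n.+1) : 0 <= rrt_prob R w.
  by apply: prodr_ge0 => t _; rewrite invr_ge0.
have mass1 : \sum_(w : choices n.+1) rrt_prob R w = 1.
  rewrite -(tree_mean_cst n (1 : R)) -rrt_mean_rtree //.
  by apply: eq_bigr => w _; rewrite mulr1.
apply: le_trans (ler_norm_sum _ _ _) _.
rewrite -[leRHS]mul1r -mass1 mulr_suml; apply: ler_sum => w _.
by rewrite -mulrBr normrM ger0_norm // ler_wpM2l.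
Qed.

Lemma harm_le_lnM :
  exists2 c : R, 0 <= c & forall n, L n.+1 <= c * ln (n.+2%:R : R).
Proof.
have ln2 : 0 < ln (2 : R) by rewrite ln_gt0 // ltr1n.
exists (2 / ln 2 + 1); first by rewrite addr_ge0 // divr_ge0 // ltW.
move=> n; apply: le_trans (harm_le_ln R n) _; rewrite mulrDl mul1r lerD //.
  by rewrite mulrAC ler_pdivlMr // ler_wpM2l // ler_ln ?posrE // ler_nat.
by rewrite ler_ln ?posrE // ler_nat.
Qed.

(** A count that stays within a constant [b] of an elimination scheme has the
    limiting fraction and the rate of the scheme, up to an error [b / n]. *)
Lemma count_rate (F : nat -> bool -> nat -> nat -> bool) (k b : nat)
    (N : forall V : finType, rel V -> nat) :
  (forall (V : finType) (e : rel V),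
     (N V e <= deaths F e k + b)%N /\ (deaths F e k <= N V e + b)%N) ->
  let frac n := rrt_mean (fun w : choices n => (N _ (rtree w))%:R / n%:R : R) in
  exists C : R, forall n, (2 <= n)%N ->
    `|frac n - limn frac| <= C * ln (n%:R : R) ^+ k.+1 / n%:R.
Proof.
move=> Nb frac.
have [l [C rate]] := split_recursion_rate (mean_deaths_recursion R F k).
have L1 n : 1 <= L n ^+ k.+1 by rewrite exprn_ege1 // harm_ge1.
have frac_mean n : `|frac n.+1 - mean_deaths R F k n / n.+1%:R| <= b%:R / n.+1%:R.
  rewrite /mean_deaths -rrt_mean_rtree;
    last exact: (invariant_deaths F (fun m => m%:R)).
  have -> : rrt_mean (fun w : choices n.+1 =>
      (deaths F (@adj (rooted_rtree w)) k)%:R : R) / n.+1%:R =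
      rrt_mean (fun w : choices n.+1 => (deaths F (rtree w) k)%:R / n.+1%:R).
    by rewrite /rrt_mean mulr_suml; apply: eq_bigr => w _; rewrite mulrA.
  apply: rrt_mean_dist => w /=.
  rewrite -mulrBl normrM [X in _ * X]ger0_norm ?invr_ge0 //.
  rewrite ler_wpM2r ?invr_ge0 //; have [] := Nb _ (rtree w).
  rewrite -!(ler_nat R) !natrD ler_distl => *; apply/andP; split; lra.
have dist_l n : `|frac n.+2 - l| <= (b%:R + C) * (L n.+1 ^+ k.+1 / n.+2%:R).
  rewrite [leRHS]mulrDl.
  rewrite (_ : frac n.+2 - l = (frac n.+2 - mean_deaths R F k n.+1 / n.+2%:R) +
    (mean_deaths R F k n.+1 / n.+2%:R - l)); last by rewrite addrA subrK.
  apply: le_trans (ler_normD _ _) _; apply: lerD (rate n).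
  apply: le_trans (frac_mean n.+1) _; rewrite ler_wpM2l //.
  by rewrite ler_peMl // invr_ge0.
have lim_frac : limn frac = l.
  have bound0 : ((fun n => (b%:R + C) * (L n.+1 ^+ k.+1 / n.+2%:R))
      @ \oo --> (0 : R))%classic.
    rewrite -[X in (_ --> X)%classic](mulr0 (b%:R + C)); apply: cvgMr.
    by have := @cvg_harm_pow R k.+1; rewrite -cvg_shiftS.
  have cvg_frac : ((fun n => frac n.+2) @ \oo --> l)%classic.
    apply/cvgrPdist_le => eps eps0; have /cvgr0_norm_le/(_ eps eps0) := bound0.
    apply: filterS => n; rewrite distrC; apply: le_trans.
    exact: le_trans (dist_l n) (ler_norm _).
  apply/cvg_lim => //; rewrite -cvg_shiftS.
  by rewrite -(@cvg_shiftS _ (fun n => frac n.+1)).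
have [c c0 Lc] := harm_le_lnM.
have bC0 : 0 <= b%:R + C.
  have := le_trans (normr_ge0 _) (dist_l 0%N).
  by rewrite pmulr_lge0 // divr_gt0 // (lt_le_trans ltr01).
exists ((b%:R + C) * c ^+ k.+1) => -[|[|n]] // _.
rewrite lim_frac -mulrA; apply: le_trans (dist_l n) _.
rewrite -!mulrA ler_wpM2l // mulrA -exprMn ler_wpM2r ?invr_ge0 //.
have Ln0 : 0 <= L n.+1 := le_trans ler01 (harm_ge1 R n.+1).
by apply: lerXn2r; rewrite ?nnegrE // (le_trans Ln0) // Lc.
Qed.

End FractionRate.

Theorem theorem6 (R : realType) (k : nat) :
  exists C : R, forall n : nat, (2 <= n)%N ->
    `|rank_frac R k n - rank_lim R k| <= C * ln (n%:R : R) ^+ k.+1 / n%:R /\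
    `|layer_frac R k n - layer_lim R k| <= C * ln (n%:R : R) ^+ k.+1 / n%:R.
Proof.
have [C1 rank_rate] := count_rate R (fun V e => @rank_nodes_deaths V e k).
have [C2 layer_rate] := count_rate R (fun V e => @layer_nodes_deaths V e k).
exists (Num.max C1 C2) => n n2.
have ln0 : 0 <= ln (n%:R : R) ^+ k.+1 by rewrite exprn_ge0 // ln_ge0 // ler1n ltnW.
have scale C : C <= Num.max C1 C2 ->
    C * ln (n%:R : R) ^+ k.+1 / n%:R <=
    Num.max C1 C2 * ln (n%:R : R) ^+ k.+1 / n%:R.
  by move=> leC; rewrite ler_wpM2r ?invr_ge0 // ler_wpM2r.
split; first by apply: le_trans (rank_rate n n2) (scale _ _); rewrite le_max lexx.
by apply: le_trans (layer_rate n n2) (scale _ _); rewrite le_max lexx orbT.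
Qed.
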